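(* Let $n\ge 1$, let $W$ be a symmetric positive definite real $n\times n$ matrix, let $a<b$ be real numbers, and let $m\ge 0$, $M\ge 0$ and $\nu_m\ge 0$ be integers satisfying $m+\nu_m\le\max\{0,M-1\}$. Then for every continuously differentiable $f:[a,b]\to\mathbf{R}^n$ the functional $$J_{W,m,a,b}(f')=\int_a^b\left(\frac{s-a}{b-a}\right)^m f'(s)^T W f'(s)\,ds$$ satisfies $$J_{W,m,a,b}(f')\ \ge\ \frac{1}{b-a}\,\widetilde{\Phi}_M^T\,(\mathcal{Z}_m\otimes I)^T\,\mathcal{W}_m\,(\mathcal{Z}_m\otimes I)\,\widetilde{\Phi}_M ,$$ where $I$ is the $n\times n$ identity matrix, $\mathcal{W}_m=\mathrm{diag}\{m+1,\,m+3,\,\ldots,\,m+2\nu_m+1\}\otimes W$, and $$\widetilde{\Phi}_M=\mathrm{col}\left\{f(b),\,f(a),\,\tfrac{1}{b-a}\phi_0,\ldots,\tfrac{1}{b-a}\phi_{M-1}\right\}\ \text{ if } M>0,\qquad \widetilde{\Phi}_0=\mathrm{col}\{f(b),f(a)\},$$ with $\phi_l=\int_a^b p_{0,l}(s)f(s)\,ds$; the polynomials $p_{0,l}$ and the matrix $\mathcal{Z}_m\in\mathbf{R}^{(\nu_m+1)\times(M+2)}$ are defined in the context.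
   Context: $\otimes$ denotes the Kronecker product and $\mathrm{col}\{\cdot\}$ stacks vectors into one column. For integers $m,n\ge 0$ define polynomials of degree $n$ by $P_{m,0}(x)\equiv 1$ and $$P_{m,n}(x)=\frac{1}{n!}\,\frac{1}{x^m}\,\frac{d^n}{dx^n}\left(x^m(x^2-x)^n\right),\quad n=1,2,\ldots$$ (for fixed $m$ these are orthogonal on $[0,1]$ with weight $x^m$). On $[a,b]$ put $p_{m,n}(t)=P_{m,n}\left(\frac{t-a}{b-a}\right)$. For $j=0,\ldots,\nu_m$ let $q_{m,m+j}(x)=x^mP_{m,j}(x)$, a polynomial of degree $m+j$, and let $\zeta^m_{j,l}$ ($0\le l\le M-1$) be the coefficients of its derivative (with respect to $x$) in the basis $P_{0,0},\ldots,P_{0,M-1}$: $$q'_{m,m+j}(x)=\sum_{l=0}^{M-1}\zeta^m_{j,l}P_{0,l}(x)$$ (so $\zeta^m_{j,l}=0$ if $m+j\le l\le M-1$; if $M=0$ there are no coefficients). Set $$\underline{\zeta}^0_j=\left(1,\,(-1)^{j+1},\,-\zeta^0_{j,0},\ldots,-\zeta^0_{j,M-1}\right)\ (m=0),\qquad \underline{\zeta}^m_j=\left(1,\,0,\,-\zeta^m_{j,0},\ldots,-\zeta^m_{j,M-1}\right)\ (m>0).$$ $\mathcal{Z}_m\in\mathbf{R}^{(\nu_m+1)\times(M+2)}$ is the matrix with rows $\underline{\zeta}^m_0,\ldots,\underline{\zeta}^m_{\nu_m}$. *)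

(* Defs.v *)
From HB Require Import structures.
From mathcomp Require Import all_boot all_order all_algebra.
From mathcomp.real_closed Require Import mxtens.
From mathcomp Require Import all_classical all_reals all_analysis.

Set Implicit Arguments.
Unset Strict Implicit.
Unset Printing Implicit Defensive.

Import Order.TTheory GRing.Theory Num.Theory numFieldNormedType.Exports.

Local Open Scope classical_set_scope.
Local Open Scope ring_scope.

Section Polynomials.
Context {R : realType}.
Implicit Types (m n nu M j : nat) (a b t : R).

(* The Rodrigues formula also gives P_{m,0} = 1 (lemma [rodrigues0]), and the
   division by 'X^m is exact (lemma [rodriguesM]). *)
Definition rodrigues m n : {poly R} :=
  (n`!%:R)^-1 *: (('X^m * ('X^2 - 'X) ^+ n)^`(n) %/ 'X^m).

Lemma rodrigues0 m : rodrigues m 0 = 1.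
Proof.
rewrite /rodrigues fact0 invr1 scale1r expr0 mulr1 derivn0 divpp //.
by rewrite monic_neq0 ?monicXn.
Qed.

Lemma rodriguesM m n :
  'X^m * rodrigues m n = (n`!%:R)^-1 *: ('X^m * ('X^2 - 'X) ^+ n)^`(n).
Proof.
rewrite /rodrigues -scalerAr mulrC divpK //.
have -> : 'X^m * ('X^2 - 'X) ^+ n = ('X - 1) ^+ n * 'X^(m + n) :> {poly R}.
  rewrite exprD mulrCA; congr (_ * _).
  by rewrite -exprMn mulrBl mul1r -expr2.
elim: n (_ ^+ n) => [|n IH] q; first by rewrite addn0 derivn0 dvdp_mull.
rewrite derivSn derivM derivXn addnS /=.
by rewrite exprS mulrA mulrnAr -mulrnAl -mulrDl; exact: IH.
Qed.

Lemma size_rodrigues0 n : size (rodrigues 0 n) = n.+1.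
Proof.
rewrite -[rodrigues 0 n]mul1r -(expr0 'X) rodriguesM expr0 mul1r.
have n0 : (n`!%:R)^-1 != 0 :> R by rewrite invr_eq0 pnatr_eq0 -lt0n fact_gt0.
rewrite size_scale //.
set p := _ ^+ n.
have X1 : 'X^2 - 'X = 'X * ('X - 1%:P) :> {poly R}.
  by rewrite mulrBr mulr1 expr2.
have pm : p \is monic by rewrite monic_exp // X1 monicMl ?monicX ?monicXsubC.
have sp : size p = (n + n).+1.
  rewrite -[size p]prednK ?size_poly_gt0 ?monic_neq0 // size_exp X1.
  by rewrite size_monicM ?monicX ?polyXsubC_eq0 // size_polyX size_XsubC mul2n -addnn.
apply/anti_leq/andP; split.
  apply/leq_sizeP => i lei; rewrite coef_derivn nth_default ?mul0rn //.
  by rewrite sp -addnS leq_add2l.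
rewrite ltnNge; apply/negP => /leq_sizeP/(_ n (leqnn n)).
rewrite coef_derivn.
have -> : p`_(n + n) = 1 by move/monicP: pm; rewrite lead_coefE sp.
by move/eqP; rewrite pnatr_eq0 eqn0Ngt ffact_gt0 leq_addr.
Qed.

Definition rodrigues_on a b m n t : R := (rodrigues m n).[(t - a) / (b - a)].

Definition legendre_basis M : M.-tuple {poly_M R} :=
  [tuple npolyp M (rodrigues 0 l) | l < M].

Lemma legendre_basisP M : basis_of fullv (legendre_basis M).
Proof.
rewrite basisEdim size_tuple dim_polyn leqnn andbT.
apply/subvP => p _.
have [k] := ubnP (size p); elim: k p => // k IH p; rewrite ltnS => spk.
have [->|p0] := eqVneq p 0; first exact: mem0v.
have szp0 : (0 < size p)%N by rewrite size_poly_gt0.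
set d := (size p).-1; have spd : size p = d.+1 by rewrite prednK.
have dM : (d < M)%N by rewrite -spd size_npoly.
pose P := npolyp M (rodrigues 0 d).
have PE : P = rodrigues 0 d :> {poly R} by rewrite npolypK // size_rodrigues0.
have PB : P \in <<legendre_basis M>>%VS.
  apply: memv_span; apply/tnthP; exists (Ordinal dM).
  by rewrite tnth_map tnth_ord_tuple.
pose c := lead_coef p / lead_coef (rodrigues 0 d).
rewrite -[p](subrK (c *: P)) memvD ?memvZ // IH //.
apply: leq_trans spk; rewrite spd ltnS; apply/leq_sizeP => i.
rewrite leq_eqVlt => /predU1P[<-|di] /=; rewrite PE coefB coefZ.
  have l0 : lead_coef (rodrigues 0 d) != 0.
    by rewrite lead_coef_eq0 -size_poly_gt0 size_rodrigues0.
  have -> : (rodrigues 0 d)`_d = lead_coef (rodrigues 0 d).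
    by rewrite lead_coefE size_rodrigues0.
  by rewrite /c divfK // lead_coefE spd subrr.
by rewrite !nth_default ?mulr0 ?subrr ?size_rodrigues0 ?spd.
Qed.

Definition qpol m j : {poly R} := 'X^m * rodrigues m j.

(* [npolyp M] truncates to degree < M; in the range of [zetaE] this leaves
   q' unchanged. *)
Definition zeta m M j (l : 'I_M) : R :=
  coord (legendre_basis M) l (npolyp M (qpol m j)^`()).

Lemma zetaE m M j : (m + j <= M)%N ->
  (qpol m j)^`() = \sum_(l < M) zeta m j l *: rodrigues 0 l.
Proof.
move=> mjM.
have sq : (size (qpol m j)^`() <= M)%N.
  have sz : (size (qpol m j) <= (m + j).+1)%N.
    rewrite /qpol rodriguesM (leq_trans (size_scale_leq _ _)) //.
    apply/leq_sizeP => i lei; rewrite coef_derivn nth_default ?mul0rn //.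
    have sX : (size ('X^2 - 'X : {poly R})%R <= 3)%N.
      by rewrite (leq_trans (size_polyD _ _)) // size_polyN size_polyXn size_polyX.
    rewrite (leq_trans (size_polyMleq _ _)) // size_polyXn addSn /=.
    rewrite (leq_trans (leq_add (leqnn m) (size_poly_exp_leq _ _))) // addnS.
    apply: (@leq_trans (j + (m + j).+1)%N); last by rewrite leq_add2l.
    rewrite addnS ltnS addnCA leq_add2l addnn -mul2n leq_mul2r.
    by rewrite -subn1 leq_subLR sX orbT.
  apply/leq_sizeP => i lei; rewrite coef_deriv nth_default ?mul0rn //.
  by apply: leq_trans sz _; rewrite ltnS (leq_trans mjM).
rewrite -[LHS](npolypK sq).
rewrite [npolyp _ _ in LHS](coord_basis (legendre_basisP M)) ?memvf //.
rewrite raddf_sum /=; apply: eq_bigr => l _; congr (_ *: _).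
rewrite (nth_map l) ?size_enum_ord //= nth_ord_enum npolypK //.
by rewrite size_rodrigues0.
Qed.

Definition Zmx m nu M : 'M[R]_(nu.+1, M.+2) :=
  row_mx (row_mx (\col_(j < nu.+1) 1)
                 (\col_(j < nu.+1) (if m == 0%N then (-1) ^+ j.+1 else 0)))
         (\matrix_(j < nu.+1, l < M) - zeta m j l).

End Polynomials.

Section Functional.
Context {R : realType} {n : nat}.
Implicit Types (m nu M l : nat) (a b s t : R) (f df g : R -> 'cV[R]_n).
Implicit Types (W : 'M[R]_n).

Definition sym_posdef W :=
  W^T = W /\ forall x : 'cV[R]_n, x != 0 -> 0 < (x^T *m W *m x) 0 0.

(* [f] is continuously differentiable on [a, b] with derivative [df]; the
   difference quotients stay inside [a, b], so the derivatives at the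
   endpoints are one-sided and values outside [a, b] are irrelevant. *)
Definition C1_with_derivative a b f df :=
  (forall t, t \in `[a, b] ->
     (s - t)^-1 *: (f s - f t) @[s --> within `[a, b] t^'] --> df t) /\
  {within `[a, b], continuous df}.

Definition J W m a b g : R :=
  \int[lebesgue_measure]_(s in `[a, b])
    (((s - a) / (b - a)) ^+ m * ((g s)^T *m W *m g s) 0 0).

Definition phi a b f l : 'cV[R]_n :=
  \col_i \int[lebesgue_measure]_(s in `[a, b]) (rodrigues_on a b 0 l s * f s i 0).

(* Column stacking, in the index order of the Kronecker product [tensmx]. *)
Definition stack k (v : 'I_k -> 'cV[R]_n) : 'cV[R]_(k * n) :=
  \col_i v (mxtens_unindex i).1 (mxtens_unindex i).2 0.

Definition Phi a b M f : 'cV[R]_(M.+2 * n) :=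
  stack (fun k : 'I_M.+2 =>
    match nat_of_ord k with
    | 0 => f b
    | 1 => f a
    | l.+2 => (b - a)^-1 *: phi a b f l
    end).

Definition Wmx W m nu : 'M[R]_(nu.+1 * n) :=
  diag_mx (\row_(j < nu.+1) (m + 2 * j + 1)%:R) *t W.

End Functional.

(* Main.v *)
Require Import Defs.
From HB Require Import structures.
From mathcomp Require Import all_boot all_order all_algebra.
From mathcomp.real_closed Require Import mxtens.
From mathcomp Require Import all_classical all_reals all_analysis.
From mathcomp Require Import ring.

Set Implicit Arguments.
Unset Strict Implicit.
Unset Printing Implicit Defensive.

Import Order.TTheory GRing.Theory Num.Theory numFieldNormedType.Exports.

Local Open Scope classical_set_scope.
Local Open Scope ring_scope.

(* Put x(s) = (s - a) / (b - a) and v_j = int_a^b q_{m,m+j}(x(s)) f'(s) ds.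
   Integrating by parts, with q_{m,m+j}(1) = 1 and q_{m,m+j}(0) = (-1)^j or 0,
   the blocks of (Z_m (x) I) Phi are exactly the v_j.  On [0, 1] the P_{m,j} are
   orthogonal for the weight x^m, with squared norms 1 / (m + 2 j + 1), so the
   claim is Bessel's inequality for f' in the weighted space with metric W. *)

(** * Derivatives of a polynomial at a multiple root *)

Lemma derivn_exp_XsubC_mul (K : comNzRingType) (c : K) k i (q : {poly K}) :
  exists2 r, (('X - c%:P) ^+ (k + i) * q)^`(i) = ('X - c%:P) ^+ k * r
    & r.[c] = ((k + i) ^_ i)%:R * q.[c].
Proof.
elim: i k q => [|i IH] k q.
  by exists q; rewrite ?addn0 ?derivn0 // mul1r.
(* The new cofactor comes from differentiating once: ((x - c)^(k+i+1) q)' = (x - c)^(k+i) ((k+i+1) q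
   + (x - c) q'). At c only the first summand survives, which builds up the falling factorial. *)
have [r rE rc] := IH k ((k + i).+1%:R *: q + ('X - c%:P) * q^`()).
exists r.
  rewrite derivSn -rE; congr (_ ^`(_)).
  rewrite derivM deriv_exp derivXsubC mul1r addnS /= exprS.
  by rewrite -[_ *+ _]mulr_natl -mul_polyC polyC_natr; ring.
by rewrite rc addnS ffactSS natrM !hornerE subrr mul0r addr0 mulrCA mulrA.
Qed.

Lemma derivn_exp_XsubC_root (K : comNzRingType) (c : K) n i (q : {poly K}) :
  (i < n)%N -> ((('X - c%:P) ^+ n * q)^`(i)).[c] = 0.
Proof.
move=> lt_in; have [r] := derivn_exp_XsubC_mul c (n - i) i q.
rewrite subnK 1?ltnW // => -> _.
by rewrite hornerM horner_exp hornerXsubC subrr expr0n subn_eq0 leqNgt lt_in mul0r.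
Qed.

Lemma derivn_exp_XsubC_fact (K : comNzRingType) (c : K) n (q : {poly K}) :
  ((('X - c%:P) ^+ n * q)^`(n)).[c] = n`!%:R * q.[c].
Proof.
have [r] := derivn_exp_XsubC_mul c 0 n q.
by rewrite add0n expr0 mul1r => -> ->; rewrite ffactnn.
Qed.

(** * Endpoint values, orthogonality and norms of the Rodrigues polynomials *)

Section RodriguesTheory.
Context {R : realType}.
Implicit Types (m i j : nat) (p g : {poly R}).

(** Displays the root 0 with its multiplicity m + j; [rodrigues_baseE1] does the same for the root
    1, of multiplicity j. *)
Lemma rodrigues_baseE0 m j :
  'X^m * ('X^2 - 'X) ^+ j = ('X - 0%:P) ^+ (m + j) * ('X - 1) ^+ j :> {poly R}.
Proof. by rewrite subr0 exprD -mulrA -exprMn; congr (_ * _ ^+ _); ring. Qed.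

Lemma rodrigues_baseE1 m j :
  'X^m * ('X^2 - 'X) ^+ j = ('X - 1%:P) ^+ j * 'X^(m + j) :> {poly R}.
Proof. by rewrite rodrigues_baseE0 subr0 mulrC. Qed.

Lemma rodrigues_base_root m i j : (i < j)%N ->
  (('X^m * ('X^2 - 'X) ^+ j)^`(i)).[0] = 0 :> R /\
  (('X^m * ('X^2 - 'X) ^+ j)^`(i)).[1] = 0 :> R.
Proof.
move=> ij; split.
  by rewrite rodrigues_baseE0 derivn_exp_XsubC_root // ltn_addl.
by rewrite rodrigues_baseE1 derivn_exp_XsubC_root.
Qed.

Let fact_neq0 j : (j`!%:R : R) != 0.
Proof. by rewrite pnatr_eq0 -lt0n fact_gt0. Qed.

(** At 1 all j derivatives must fall on (x - 1)^j, and the resulting j! cancels the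
    normalisation. *)
Lemma qpol_horner1 m j : (qpol m j).[1] = 1 :> R.
Proof.
rewrite /qpol rodriguesM hornerZ rodrigues_baseE1 derivn_exp_XsubC_fact.
by rewrite hornerXn expr1n mulr1 mulVf.
Qed.

Lemma rodrigues_horner1 m j : (rodrigues m j).[1] = 1 :> R.
Proof. by rewrite -[RHS](qpol_horner1 m j) hornerM hornerXn expr1n mul1r. Qed.

(** For m > 0 the factor x^m vanishes. For m = 0 all j derivatives fall on x^j, leaving (x - 1)^j at
    0. *)
Lemma qpol_horner0 m j : (qpol m j).[0] = if m == 0%N then (-1) ^+ j else 0 :> R.
Proof.
rewrite /qpol; case: eqP => [->|/eqP m0]; last first.
  by rewrite hornerM hornerXn expr0n (negPf m0) mul0r.
rewrite rodriguesM hornerZ rodrigues_baseE0 add0n derivn_exp_XsubC_fact.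
by rewrite mulKf // horner_exp -polyC1 hornerXsubC sub0r.
Qed.

(** Degree count: m + 2j, minus j for the derivatives, minus m for the division by x^m. *)
Lemma size_rodrigues m j : (size (rodrigues m j : {poly R}) <= j.+1)%N.
Proof.
have [->|P0] := eqVneq (rodrigues m j : {poly R}) 0; first by rewrite size_poly0.
have -> : size (rodrigues m j : {poly R}) =
    (size ('X^m * rodrigues m j : {poly R})%R - m)%N.
  by rewrite mulrC size_mulXn // addKn.
rewrite leq_subLR rodriguesM (leq_trans (size_scale_leq _ _)) //.
apply/leq_sizeP => i lei; rewrite coef_derivn nth_default ?mul0rn //.
rewrite rodrigues_baseE1 size_monicM ?monic_exp ?monicXsubC //; last first.
  by rewrite monic_neq0 ?monicXn.
by rewrite size_polyXn size_exp_XsubC addSn /= leq_add2l -addnS.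
Qed.

(** Product rule with x p' split as j p + (x p' - j p); when p has degree at most j, the bracket
    loses the term of degree j. *)
Lemma deriv_weighted_square m j p :
  ('X^(m.+1) * p * p)^`() = (m + 2 * j + 1)%:R *: ('X^m * p * p)
    + 2 *: ('X^m * p * ('X * p^`() - j%:R *: p)).
Proof.
rewrite !derivM derivXn /= exprS -mulr_natl -!mul_polyC !polyC_natr.
rewrite natrD (natrD _ m) natrM -natr1.
move: p^`() ('X^m : {poly R}) ('X : {poly R}) (m%:R : {poly R})
  (j%:R : {poly R}) => ? ? ? ? ?; ring.
Qed.

(* Every linear functional with this property is integration over [0, 1]. *)
Variable I : {linear {poly R} -> R^o}.
Hypothesis I_deriv : forall p, I p^`() = p.[1] - p.[0].

Lemma functional_by_parts p g :
  I (p^`() * g) = p.[1] * g.[1] - p.[0] * g.[0] - I (p * g^`()).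
Proof. by rewrite -!hornerM -I_deriv derivM raddfD addrK. Qed.

(** The vanishing derivatives of p remove every boundary term. *)
Lemma functional_by_partsn n p g :
  (forall i, (i < n)%N -> (p^`(i)).[0] = 0 /\ (p^`(i)).[1] = 0) ->
  I (p^`(n) * g) = (-1) ^+ n * I (p * g^`(n)).
Proof.
elim: n g => [|n IH] g hp; first by rewrite !derivn0 expr0 mul1r.
have [pn0 pn1] := hp n (ltnSn n).
rewrite derivnS functional_by_parts pn0 pn1 !mul0r subrr sub0r.
rewrite IH => [|i /ltnW/hp//].
by rewrite -derivSn exprS mulN1r mulNr.
Qed.

(** Integrating by parts j times moves all derivatives of the Rodrigues formula onto g, whose degree
    is below j. *)
Lemma rodrigues_orthogonal m j g : (size g <= j)%N -> I (qpol m j * g) = 0.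
Proof.
move=> sg; rewrite /qpol rodriguesM -scalerAl linearZ /=.
rewrite functional_by_partsn; last by move=> i; exact: rodrigues_base_root.
by rewrite derivn_poly0 // mulr0 raddf0 mulr0 scaler0.
Qed.

(* Integrate (x^(m+1) P_j^2)', using that x P_j' - j P_j has degree < j. *)
Lemma rodrigues_norm m j :
  I (qpol m j * rodrigues m j) = ((m + 2 * j + 1)%:R)^-1.
Proof.
have := I_deriv ('X^(m.+1) * rodrigues m j * rodrigues m j).
rewrite (deriv_weighted_square m j) -/(qpol m j) linearD.
rewrite [X in X + _]linearZ [X in _ + X]linearZ.
rewrite (@rodrigues_orthogonal _ _ ('X * _ - _)); last first.
  (* Coefficient i of x P' - j P is (i - j) times that of P: zero at i = j, and zero beyond because
     P has degree at most j. *)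
  apply/leq_sizeP => i ji; rewrite coefB coefXM coefZ coef_deriv.
  case: i ji => [|i]; rewrite ?leqn0.
    by move/eqP->; rewrite mul0r subr0.
  rewrite leq_eqVlt /= => /predU1P[->|ji]; first by rewrite mulr_natl subrr.
  by rewrite nth_default ?mul0rn ?mulr0 ?subr0 // (leq_trans (size_rodrigues m j)).
rewrite /= scaler0 addr0 !hornerM !hornerXn expr1n !rodrigues_horner1 expr0n.
rewrite !mul0r subr0 !mulr1 => E.
have n0 : (m + 2 * j + 1)%:R != 0 :> R by rewrite pnatr_eq0 addn1.
by apply: (mulfI n0); rewrite mulfV.
Qed.

Lemma rodrigues_orthonormal m i j :
  I (qpol m i * rodrigues m j) = if i == j then ((m + 2 * j + 1)%:R)^-1 else 0.
Proof.
case: (ltngtP i j) => [ij|ji|->]; last exact: rodrigues_norm.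
  (* The weight x^m moves to the factor of larger index, so that the other one has smaller
     degree. *)
  rewrite /qpol mulrAC -/(qpol _ _).
  by rewrite rodrigues_orthogonal // (leq_trans (size_rodrigues m i)).
by rewrite rodrigues_orthogonal // (leq_trans (size_rodrigues m j)).
Qed.

End RodriguesTheory.

(** * From difference quotients on a segment to continuity and interior derivatives *)

Section OneSidedDerivative.
Context {R : realType}.
Variables (a b : R) (g dg : R -> R).
Hypothesis g_dg : forall t, t \in `[a, b] ->
  (s - t)^-1 * (g s - g t) @[s --> within `[a, b] t^'] --> dg t.

(** Off t, g s is (s - t) times the quotient plus g t, and this tends to 0 * dg t + g t. *)
Lemma quotient_within_continuous : {within `[a, b], continuous g}.
Proof.
apply/subspace_continuousP => t tab.
have dcvg : g s @[s --> within `[a, b] t^'] --> g t.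
  have h : (s - t) * ((s - t)^-1 * (g s - g t)) + g t
      @[s --> within `[a, b] t^'] --> (t - t) * dg t + g t.
    apply: cvgD; last exact: cvg_cst.
    apply: cvgM; last exact: g_dg.
    apply: cvgB; last exact: cvg_cst.
    apply: cvg_within_filter; exact: nbhs_dnbhs.
  rewrite subrr mul0r add0r in h.
  apply: cvg_trans h; apply: near_eq_cvg.
  rewrite near_withinE /dnbhs near_withinE; apply: nearW => s st _.
  by rewrite mulVKf ?subrK // subr_eq0.
move=> U Ut; have hU : \forall s \near t, s != t -> `[a, b]%classic s -> U (g s).
  exact: dcvg Ut.
suff : \forall s \near t, `[a, b]%classic s -> U (g s) by [].
apply: filterS hU => s hs sab.
(* The limit so far is punctured; the missing point s = t lies in U because g t does. *)
by have [->|st] := eqVneq s t; [exact: nbhs_singleton|exact: hs].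
Qed.

(** Near an interior point the restriction to the segment is automatic; the substitution s = h + t
    then gives the limit defining the derivative in direction 1. *)
Lemma quotient_is_derive t : t \in `]a, b[ -> is_derive t 1 g (dg t).
Proof.
move=> tab.
have h : (s - t)^-1 * (g s - g t) @[s --> t^'] --> dg t.
  move=> U /(g_dg (subset_itv_oo_cc tab)) hU.
  have {}hU : \forall s \near t, s != t -> `[a, b]%classic s ->
      U ((s - t)^-1 * (g s - g t)).
    exact: hU.
  suff : \forall s \near t, s != t -> U ((s - t)^-1 * (g s - g t)) by [].
  apply: filterS2 hU (near_in_itvoo tab) => s hs sab st.
  by apply: hs => //; exact: (subset_itv_oo_cc sab).
have sh : h + t @[h --> (0 : R)^'] --> t^'.
  move=> U tU; have {}tU : \forall s \near t, s != t -> U s by exact: tU.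
  suff : \forall h \near (0 : R), h != 0 -> U (h + t) by [].
  move: tU; rewrite (near_shift 0) subr0; apply: filterS => e /= eU e0.
  by apply: eU; rewrite -subr_eq0 addrK.
have q : h^-1 *: ((g \o shift t) (h *: 1) - g t) @[h --> 0^'] --> dg t.
  have := cvg_comp _ _ sh h.
  apply: cvg_trans; apply: near_eq_cvg; apply: nearW => s /=.
  by rewrite addrK /GRing.scale /= mulr1.
apply: DeriveDef; first by apply/cvg_ex; exists (dg t).
exact: cvg_lim q.
Qed.

End OneSidedDerivative.

(** * Integrals over [a, b] and the change of variable x(s) *)

Section SegmentIntegral.
Context {R : realType} {a b : R}.
Hypothesis ab : a < b.
Implicit Types (g h : R -> R) (p q : {poly R}) (c : R).
Local Notation mu := (@lebesgue_measure R).
Local Notation continuous_ab g := {within `[a, b], continuous (g : R -> R)}.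

Lemma within_continuousD g h : continuous_ab g -> continuous_ab h ->
  continuous_ab (fun s => g s + h s).
Proof. by move=> cg ch z; apply: cvgD; [exact: cg|exact: ch]. Qed.

Lemma within_continuousM g h : continuous_ab g -> continuous_ab h ->
  continuous_ab (fun s => g s * h s).
Proof. by move=> cg ch z; apply: cvgM; [exact: cg|exact: ch]. Qed.

Lemma within_continuous_cst c : continuous_ab (fun=> c).
Proof. by move=> z; exact: cvg_cst. Qed.

Lemma within_continuous_horner p : continuous_ab (horner p).
Proof. by apply: continuous_subspaceT => z; exact: continuous_horner. Qed.

Lemma within_continuous_sum k (F : 'I_k -> R -> R) :
  (forall i, continuous_ab (F i)) -> continuous_ab (fun s => \sum_i F i s).
Proof.
move=> cF; rewrite (_ : (fun _ => _) = \sum_i F i); last first.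
  by apply/funext => s; rewrite fct_sumE.
elim/big_ind: _ => [|g h cg ch|i _]; last exact: cF.
- exact: within_continuous_cst.
- exact: within_continuousD.
Qed.

Lemma within_continuous_integrable g :
  continuous_ab g -> mu.-integrable `[a, b] (EFin \o g).
Proof. by apply: continuous_compact_integrable; exact: segment_compact. Qed.

Lemma Rintegral_itvD g h : continuous_ab g -> continuous_ab h ->
  \int[mu]_(s in `[a, b]) (g s + h s) =
  \int[mu]_(s in `[a, b]) g s + \int[mu]_(s in `[a, b]) h s.
Proof. by move=> cg ch; apply: RintegralD => //; exact: within_continuous_integrable. Qed.

Lemma Rintegral_itvZ c g : continuous_ab g ->
  \int[mu]_(s in `[a, b]) (c * g s) = c * \int[mu]_(s in `[a, b]) g s.
Proof. by move=> cg; apply: RintegralZl => //; exact: within_continuous_integrable. Qed.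

Lemma Rintegral_itv_sum k (F : 'I_k -> R -> R) :
  (forall i, continuous_ab (F i)) ->
  \int[mu]_(s in `[a, b]) (\sum_i F i s) = \sum_i \int[mu]_(s in `[a, b]) F i s.
Proof.
elim: k F => [|k IH] F cF.
  rewrite big_ord0; under eq_Rintegral do rewrite big_ord0.
  by rewrite Rintegral_cst // mul0r.
rewrite big_ord_recl -IH; last by move=> i; exact: cF.
rewrite -(@Rintegral_itvD (F ord0) (fun s => \sum_i F (lift ord0 i) s)) //.
  by apply: eq_Rintegral => s _; rewrite big_ord_recl.
by apply: within_continuous_sum => i; exact: cF.
Qed.

(** Taken as a polynomial, so that composing with it stays in [{poly R}] and is differentiated
    algebraically. *)
Definition unit_coord : {poly R} := (b - a)^-1 *: ('X - a%:P).

Lemma unit_coordE s : unit_coord.[s] = (s - a) / (b - a).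
Proof. by rewrite hornerZ hornerXsubC mulrC. Qed.

Lemma comp_unit_coordE p s : (p \Po unit_coord).[s] = p.[(s - a) / (b - a)].
Proof. by rewrite horner_comp unit_coordE. Qed.

Lemma comp_unit_coord_left p : (p \Po unit_coord).[a] = p.[0].
Proof. by rewrite comp_unit_coordE subrr mul0r. Qed.

Lemma comp_unit_coord_right p : (p \Po unit_coord).[b] = p.[1].
Proof. by rewrite comp_unit_coordE divff // subr_eq0 gt_eqF. Qed.

Lemma deriv_comp_unit_coord p :
  (p \Po unit_coord)^`() = (b - a)^-1 *: (p^`() \Po unit_coord).
Proof. by rewrite deriv_comp /unit_coord derivZ derivXsubC -scalerAr mulr1. Qed.

Lemma horner_LRcontinuous p : derivable_oo_LRcontinuous (horner p) a b.
Proof.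
split; first by move=> x _; exact: derivable_horner.
  by apply: cvg_at_right_filter; exact: continuous_horner.
by apply: cvg_at_left_filter; exact: continuous_horner.
Qed.

(** Integration of p over [0, 1], written on [a, b] so that no substitution in the integral is
    required. *)
Definition segment_functional p : R^o :=
  (b - a)^-1 * \int[mu]_(s in `[a, b]) (p \Po unit_coord).[s].

Lemma segment_functional_is_linear : linear segment_functional.
Proof.
move=> c p q; rewrite /segment_functional /GRing.scale /=.
rewrite mulrCA -mulrDr; congr (_ * _).
have cp r : continuous_ab (horner (r \Po unit_coord)).
  exact: within_continuous_horner.
under eq_Rintegral do rewrite comp_polyD comp_polyZ hornerD hornerZ.
rewrite Rintegral_itvD // ?Rintegral_itvZ //.
by apply: within_continuousM => //; exact: within_continuous_cst.
Qed.

HB.instance Definition _ := GRing.isLinear.Build R {poly R} R^o _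
  segment_functional segment_functional_is_linear.

(** The endpoints a and b correspond to x = 0 and x = 1; the chain rule produces the factor 1 / (b -
    a). *)
Lemma Rintegral_by_parts_horner p g dg :
  continuous_ab dg -> derivable_oo_LRcontinuous g a b ->
  {in `]a, b[, g^`()%classic =1 dg} ->
  \int[mu]_(s in `[a, b]) ((p \Po unit_coord).[s] * dg s) =
  p.[1] * g b - p.[0] * g a -
  (b - a)^-1 * \int[mu]_(s in `[a, b]) ((p^`() \Po unit_coord).[s] * g s).
Proof.
move=> cdg lrg gdg.
rewrite (Rintegration_by_parts ab (f := horner (p \Po unit_coord)^`()) _
  (horner_LRcontinuous _) _ cdg lrg gdg).
- rewrite comp_unit_coord_left comp_unit_coord_right; congr (_ - _).
  rewrite -Rintegral_itvZ; last first.
    apply: within_continuousM; first exact: within_continuous_horner.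
    exact: derivable_oo_LRcontinuous_within.
  apply: eq_Rintegral => s _.
  by rewrite deriv_comp_unit_coord hornerZ mulrA.
- exact: within_continuous_horner.
- by move=> s _; rewrite derivE.
Qed.

(** Integration by parts against the constant 1, whose derivative makes the left side 0. This is the
    property assumed of [I] above. *)
Lemma segment_functional_deriv p : segment_functional p^`() = p.[1] - p.[0].
Proof.
have := @Rintegral_by_parts_horner p (cst 1) (cst 0).
have lr1 : derivable_oo_LRcontinuous (cst (1 : R)) a b.
  by split => [x _||]; [exact: derivable_cst|exact: cvg_cst|exact: cvg_cst].
have c0 : continuous_ab (cst 0) by exact: within_continuous_cst.
move=> /(_ c0 lr1 (fun x _ => derive1_cst _ _)).
under eq_Rintegral do rewrite mulr0.
under [X in _ = _ - _ * X -> _]eq_Rintegral do rewrite mulr1.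
by rewrite Rintegral_cst // mul0r !mulr1 => /esym/eqP; rewrite subr_eq0 => /eqP.
Qed.

End SegmentIntegral.

(** * Kronecker products acting blockwise on stacked vectors *)

Section Stack.
Context {R : realType}.

Lemma sum_mxtens m n (F : 'I_(m * n) -> R) :
  \sum_k F k = \sum_i \sum_j F (mxtens_index (i, j)).
Proof.
rewrite pair_big /= (reindex (@mxtens_index m n)) /=; last first.
  by exists (@mxtens_unindex m n) => k _; rewrite ?mxtens_indexK ?mxtens_unindexK.
by apply: eq_bigr => -[].
Qed.

Context {n : nat}.

Lemma tensmx_stack k l (A : 'M[R]_(k, l)) (B : 'M[R]_n) (v : 'I_l -> 'cV[R]_n) :
  (A *t B) *m stack v = stack (fun i => \sum_j A i j *: (B *m v j)).
Proof.
apply/colP => r; case: (mxtens_indexP r) => i c.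
rewrite !mxE sum_mxtens mxtens_indexK /= summxE; apply: eq_bigr => j _.
rewrite mxE mxE mulr_sumr; apply: eq_bigr => d _.
by rewrite tensmxE mxE mxtens_indexK /= mulrA.
Qed.

Lemma tr_stack_mul k (u v : 'I_k -> 'cV[R]_n) :
  (stack u)^T *m stack v = \sum_i (u i)^T *m v i.
Proof.
apply/matrixP => x y; rewrite !ord1 mxE sum_mxtens summxE; apply: eq_bigr => i _.
by rewrite mxE; apply: eq_bigr => j _; rewrite !mxE mxtens_indexK.
Qed.

(** A block diagonal matrix has no cross terms, so the form splits into one W-form per block. *)
Lemma stack_quadratic k (d : 'rV[R]_k) (W : 'M[R]_n) (v : 'I_k -> 'cV[R]_n) :
  (stack v)^T *m (diag_mx d *t W) *m stack v =
  \sum_j d 0 j *: ((v j)^T *m W *m v j).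
Proof.
rewrite -mulmxA tensmx_stack tr_stack_mul; apply: eq_bigr => j _.
rewrite (bigD1 j) //= big1 ?addr0 => [|i /negPf ij]; last first.
  by rewrite mxE eq_sym ij mulr0n scale0r.
by rewrite mxE eqxx mulr1n -scalemxAr mulmxA.
Qed.

End Stack.

(** * Polynomial moments of vector functions and the rows of [Zmx] *)

Section VectorIntegral.
Context {R : realType} {n : nat}.
Variables (a b : R).
Hypothesis ab : a < b.
Implicit Types (u f df : R -> 'cV[R]_n) (p q : {poly R}).
Local Notation mu := (@lebesgue_measure R).
Local Notation continuous_ab g := {within `[a, b], continuous (g : R -> R)}.
Local Notation X := (@unit_coord R a b).

Definition coord_continuous_on u := forall i, continuous_ab (fun s => u s i 0).

(** Common form of phi_l (p = P_{0,l}, u = f) and of v_j (p = q_{m,m+j}, u = f'). *)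
Definition poly_moment p u : 'cV[R]_n :=
  \col_i \int[mu]_(s in `[a, b]) ((p \Po X).[s] * u s i 0).

Lemma phiE f l : phi a b f l = poly_moment (rodrigues 0 l) f.
Proof.
by apply/colP => i; rewrite !mxE; apply: eq_Rintegral => s _; rewrite comp_unit_coordE.
Qed.

Lemma C1_coord_continuous f df : C1_with_derivative a b f df -> coord_continuous_on df.
Proof.
move=> [_ /subspace_continuousP cdf] i; apply/subspace_continuousP => t /cdf.
apply: (continuous_cvg _ (h := fun x : 'cV[R]_n => x i 0)).
exact: coord_continuous.
Qed.

Lemma C1_coord_quotient f df i t : C1_with_derivative a b f df -> t \in `[a, b] ->
  (s - t)^-1 * (f s i 0 - f t i 0) @[s --> within `[a, b] t^'] --> df t i 0.
Proof.
move=> [+ _] tab => /(_ t tab) h.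
rewrite (_ : (fun s => _) = fun s => ((s - t)^-1 *: (f s - f t)) i 0).
  apply: (continuous_cvg _ (h := fun x : 'cV[R]_n => x i 0)) h.
  exact: coord_continuous.
by apply/funext => s; rewrite !mxE.
Qed.

(** Derivability inside comes from the interior quotients, the one-sided limits at a and b from
    continuity on the segment. *)
Lemma C1_coord_LRcontinuous f df i : C1_with_derivative a b f df ->
  derivable_oo_LRcontinuous (fun s => f s i 0) a b.
Proof.
move=> fdf; have q t tab := @C1_coord_quotient f df i t fdf tab.
have /(continuous_within_itvP _ ab)[_ fa fb] := quotient_within_continuous q.
by split=> // t tab; have [] := quotient_is_derive q tab.
Qed.

Lemma C1_coord_derive1 f df i : C1_with_derivative a b f df ->
  {in `]a, b[, (fun s => f s i 0)^`()%classic =1 (fun s => df s i 0)}.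
Proof.
move=> fdf t tab; have q s sab := @C1_coord_quotient f df i s fdf sab.
by rewrite derive1E; have [_ ->] := quotient_is_derive q tab.
Qed.

Lemma C1_coord_continuous_fun f df : C1_with_derivative a b f df -> coord_continuous_on f.
Proof.
by move=> fdf i; exact: derivable_oo_LRcontinuous_within (C1_coord_LRcontinuous i fdf).
Qed.

Lemma poly_moment_deriv p f df : C1_with_derivative a b f df ->
  poly_moment p df = p.[1] *: f b - p.[0] *: f a - (b - a)^-1 *: poly_moment p^`() f.
Proof.
move=> fdf; apply/colP => i; rewrite !mxE.
apply: (Rintegral_by_parts_horner ab).
- exact: C1_coord_continuous fdf i.
- exact: C1_coord_LRcontinuous fdf.
- exact: C1_coord_derive1 fdf.
Qed.

Lemma poly_moment_sum k (c : 'I_k -> R) (p : 'I_k -> {poly R}) u :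
  coord_continuous_on u ->
  poly_moment (\sum_l c l *: p l) u = \sum_l c l *: poly_moment (p l) u.
Proof.
move=> cu; apply/colP => i; rewrite mxE summxE.
transitivity (\int[mu]_(s in `[a, b]) \sum_l (c l * ((p l \Po X).[s] * u s i 0))).
  apply: eq_Rintegral => s _; rewrite raddf_sum horner_sum mulr_suml.
  by apply: eq_bigr => l _; rewrite /= linearZ hornerZ mulrA.
have cpu l : continuous_ab (fun s => (p l \Po X).[s] * u s i 0).
  by apply: within_continuousM => //; exact: within_continuous_horner.
rewrite Rintegral_itv_sum => [|l]; last first.
  by apply: within_continuousM => //; exact: within_continuous_cst.
by apply: eq_bigr => l _; rewrite Rintegral_itvZ // !mxE.
Qed.

(** Integration by parts of v_j: the boundary terms give the first two columns, the expansion of q'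
    in the P_{0,l} the others. *)
Lemma Zmx_row m nu M f df (j : 'I_nu.+1) : C1_with_derivative a b f df ->
  (m + j <= M)%N ->
  \sum_(k < M.+2) Zmx m nu M j k *: (match nat_of_ord k with
    | 0 => f b
    | 1 => f a
    | l.+2 => (b - a)^-1 *: phi a b f l
    end) = poly_moment (qpol m j) df.
Proof.
move=> fdf mjM; rewrite (poly_moment_deriv _ fdf) qpol_horner1 qpol_horner0 (zetaE mjM).
rewrite poly_moment_sum; last exact: C1_coord_continuous_fun fdf.
(* The M + 2 columns are split as (1 + 1) + M, following the nested [row_mx] of [Zmx]. *)
rewrite (@big_split_ord _ _ _ (1 + 1) M) /=.
rewrite (@big_split_ord _ _ _ 1 1) /= !big_ord1 -scaleNr; congr (_ *: _ + _ *: _ + _).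
- by apply: etrans (row_mxEl _ _ _ _) _; rewrite row_mxEl mxE.
- apply: etrans (row_mxEl _ _ _ _) _; rewrite row_mxEr mxE.
  by case: eqP; rewrite ?oppr0 // exprS mulN1r.
rewrite scaler_sumr -sumrN; apply: eq_bigr => l _.
rewrite phiE !scalerA -scaleNr; congr (_ *: _).
rewrite mulrC -mulrN; congr (_ * _).
by apply: etrans (row_mxEr _ _ _ _) _; rewrite mxE.
Qed.

End VectorIntegral.

(** The mixed terms are grouped with y on the left: for y the projection and x the residual,
    [Rintegral_projection_form] then evaluates both integrals. *)
Lemma quadratic_formD (K : comNzRingType) n (W : 'M[K]_n) (x y : 'cV[K]_n) :
  W^T = W ->
  ((x + y)^T *m W *m (x + y)) 0 0 = (x^T *m W *m x) 0 0 +
    ((y^T *m W *m (x + y)) 0 0 + (y^T *m W *m x) 0 0).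
Proof.
move=> Wsym.
have sym : (y^T *m W *m x) 0 0 = (x^T *m W *m y) 0 0.
  by rewrite -[y^T *m W *m x]trmxK [LHS]mxE !trmx_mul trmxK Wsym mulmxA.
have mxD (A C : 'M[K]_1) : (A + C) 0 0 = A 0 0 + C 0 0 by rewrite mxE.
by rewrite [(_ + _)^T]linearD /= !mulmxDl !mulmxDr !mxD sym; ring.
Qed.

(** * Bessel's inequality with weight x^m and metric W *)

Section Bessel.
Context {R : realType} {n : nat}.
Variables (a b : R) (m nu : nat) (W : 'M[R]_n) (u : R -> 'cV[R]_n).
Hypothesis ab : a < b.
Hypothesis cu : coord_continuous_on a b u.
Local Notation mu := (@lebesgue_measure R).
Local Notation continuous_ab g := {within `[a, b], continuous (g : R -> R)}.
Local Notation X := (@unit_coord R a b).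
Local Notation moment j w := (poly_moment a b (qpol m j) w).

Lemma coord_continuous_mulmx (z : 'rV[R]_n) (w : R -> 'cV[R]_n) :
  coord_continuous_on a b w -> continuous_ab (fun s => (z *m w s) 0 0).
Proof.
move=> cw; rewrite (_ : (fun _ => _) = fun s => \sum_i z 0 i * w s i 0); last first.
  by apply/funext => s; rewrite mxE.
apply: within_continuous_sum => i; apply: within_continuousM => //.
exact: within_continuous_cst.
Qed.

Lemma poly_moment_mulmx p (z : 'rV[R]_n) (w : R -> 'cV[R]_n) :
  coord_continuous_on a b w ->
  \int[mu]_(s in `[a, b]) ((p \Po X).[s] * (z *m w s) 0 0) =
  (z *m poly_moment a b p w) 0 0.
Proof.
move=> cw; have cpw i : continuous_ab (fun s => (p \Po X).[s] * w s i 0).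
  by apply: within_continuousM => //; exact: within_continuous_horner.
transitivity (\int[mu]_(s in `[a, b]) \sum_i (z 0 i * ((p \Po X).[s] * w s i 0))).
  apply: eq_Rintegral => s _; rewrite mxE mulr_sumr.
  by apply: eq_bigr => i _; rewrite mulrCA.
rewrite Rintegral_itv_sum => [|i]; last first.
  by apply: within_continuousM => //; exact: within_continuous_cst.
by rewrite mxE; apply: eq_bigr => i _; rewrite Rintegral_itvZ // mxE.
Qed.

(** Inverse of the weighted squared norm of P_{m,j}(x(s)) on [a, b]. *)
Let c (j : 'I_nu.+1) : R := (m + 2 * j + 1)%:R / (b - a).

(** Orthogonal projection of u onto the combinations of the P_{m,j}(x(s)), j <= nu, with vector
    coefficients, for the weight x^m. *)
Definition rodrigues_projection s : 'cV[R]_n :=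
  \sum_(j < nu.+1) (c j * (rodrigues m j \Po X).[s]) *: moment j u.

Local Notation g := rodrigues_projection.

Lemma rodrigues_projection_continuous : coord_continuous_on a b g.
Proof.
move=> i; rewrite (_ : (fun _ => _) =
    fun s => \sum_j (c j * moment j u i 0) * (rodrigues m j \Po X).[s]).
  apply: within_continuous_sum => j; apply: within_continuousM.
    exact: within_continuous_cst.
  exact: within_continuous_horner.
by apply/funext => s; rewrite summxE; apply: eq_bigr => j _; rewrite mxE mulrAC.
Qed.

Lemma residual_continuous : coord_continuous_on a b (fun s => u s - g s).
Proof.
move=> i; rewrite (_ : (fun _ => _) = fun s => u s i 0 + (-1) * g s i 0).
  apply: within_continuousD => //; apply: within_continuousM.
    exact: within_continuous_cst.
  exact: rodrigues_projection_continuous.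
by apply/funext => s; rewrite !mxE mulN1r.
Qed.

Lemma Rintegral_qpol_rodrigues j k :
  \int[mu]_(s in `[a, b]) ((qpol m j \Po X).[s] * (rodrigues m k \Po X).[s]) =
  if j == k then (b - a) / (m + 2 * k + 1)%:R else 0.
Proof.
have ba : b - a != 0 by rewrite subr_eq0 gt_eqF.
have := rodrigues_orthonormal (@segment_functional_deriv R a b ab) m j k.
rewrite /= /segment_functional => /(congr1 ( *%R (b - a))); rewrite mulVKf //.
under eq_Rintegral do rewrite comp_polyM hornerM.
by move=> ->; case: eqP => //; rewrite mulr0.
Qed.

(** Orthogonality leaves only the term k = j, where [c j] cancels the squared norm. *)
Lemma moment_projection (j : 'I_nu.+1) : moment j g = moment j u.
Proof.
apply/colP => i; rewrite mxE.
transitivity (\int[mu]_(s in `[a, b]) \sum_k ((c k * moment k u i 0) *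
    ((qpol m j \Po X).[s] * (rodrigues m k \Po X).[s]))).
  apply: eq_Rintegral => s _; rewrite summxE mulr_sumr.
  by apply: eq_bigr => k _; rewrite mxE; ring.
have cqr k : continuous_ab (fun s =>
    (qpol m j \Po X).[s] * (rodrigues m k \Po X).[s]).
  by apply: within_continuousM; exact: within_continuous_horner.
rewrite Rintegral_itv_sum => [|k]; last first.
  by apply: within_continuousM => //; exact: within_continuous_cst.
rewrite (bigD1 j) //= big1 ?addr0 => [|k /negPf kj]; last first.
  by rewrite Rintegral_itvZ // Rintegral_qpol_rodrigues val_eqE eq_sym kj mulr0.
rewrite Rintegral_itvZ // Rintegral_qpol_rodrigues eqxx.
rewrite mulrAC /c mulrA divfK ?subr_eq0 ?gt_eqF //.
by rewrite divff ?mul1r // pnatr_eq0 addn1.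
Qed.

Lemma moment_residual (j : 'I_nu.+1) : moment j (fun s => u s - g s) = 0.
Proof.
have cg := rodrigues_projection_continuous.
have cm (w : R -> 'cV[R]_n) i : coord_continuous_on a b w ->
    continuous_ab (fun s => (qpol m j \Po X).[s] * w s i 0).
  by move=> cw; apply: within_continuousM; [exact: within_continuous_horner|exact: cw].
rewrite -[RHS](subrr (moment j u)) -{2}moment_projection; apply/colP => i; rewrite !mxE.
rewrite -RintegralB //; try by apply: within_continuous_integrable; exact: cm.
by apply: eq_Rintegral => s _; rewrite !mxE mulrBr.
Qed.

(** The weight x^m turns each P_{m,j} of the projection into q_{m,m+j}, hence the moments of w. It
    serves for w = u, giving the Bessel sum, and for w the residual, giving 0. *)
Lemma Rintegral_projection_form (w : R -> 'cV[R]_n) : coord_continuous_on a b w ->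
  \int[mu]_(s in `[a, b]) (((s - a) / (b - a)) ^+ m * ((g s)^T *m W *m w s) 0 0) =
  \sum_j c j * ((moment j u)^T *m W *m moment j w) 0 0.
Proof.
move=> cw.
transitivity (\int[mu]_(s in `[a, b]) \sum_j (c j *
    ((qpol m j \Po X).[s] * ((moment j u)^T *m W *m w s) 0 0))).
  apply: eq_Rintegral => s _; rewrite /g linear_sum /= !mulmx_suml summxE mulr_sumr.
  apply: eq_bigr => j _; rewrite linearZ /= -!scalemxAl mxE.
  by rewrite !comp_unit_coordE hornerM hornerXn; ring.
have cf j : continuous_ab (fun s =>
    (qpol m j \Po X).[s] * ((moment j u)^T *m W *m w s) 0 0).
  apply: within_continuousM; first exact: within_continuous_horner.
  exact: coord_continuous_mulmx.
rewrite Rintegral_itv_sum => [|j]; last first.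
  by apply: within_continuousM => //; exact: within_continuous_cst.
by apply: eq_bigr => j _; rewrite Rintegral_itvZ // poly_moment_mulmx.
Qed.

Lemma form_continuous (w y : R -> 'cV[R]_n) :
  coord_continuous_on a b w -> coord_continuous_on a b y ->
  continuous_ab (fun s => ((s - a) / (b - a)) ^+ m * ((w s)^T *m W *m y s) 0 0).
Proof.
move=> cw cy; rewrite (_ : (fun _ => _) =
    fun s => ('X^m \Po X).[s] * \sum_i w s i 0 * (row i W *m y s) 0 0).
  apply: within_continuousM; first exact: within_continuous_horner.
  apply: within_continuous_sum => i; apply: within_continuousM; first exact: cw.
  exact: coord_continuous_mulmx.
apply/funext => s; rewrite comp_unit_coordE hornerXn -mulmxA mxE; congr (_ * _).
apply: eq_bigr => i _; rewrite mxE; congr (_ * _).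
by rewrite -row_mul [RHS]mxE.
Qed.

Lemma bessel_form : W^T = W -> (forall x : 'cV[R]_n, 0 <= (x^T *m W *m x) 0 0) ->
  \sum_j c j * ((moment j u)^T *m W *m moment j u) 0 0 <= J W m a b u.
Proof.
move=> Wsym Wge0; set h := fun s => u s - g s.
have ch : coord_continuous_on a b h by exact: residual_continuous.
have cg := rodrigues_projection_continuous.
(* u = h + g, and the cross term of g and h integrates to 0 by orthogonality. *)
pose B w y s := ((s - a) / (b - a)) ^+ m * ((w s)^T *m W *m y s : 'M[R]_1) 0 0.
have -> : J W m a b u = \int[mu]_(s in `[a, b]) (B h h s + (B g u s + B g h s)).
  apply: eq_Rintegral => s _; rewrite /B -!mulrDr; congr (_ * _).
  by rewrite -[in LHS](subrK (g s) (u s)) quadratic_formD // subrK.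
rewrite !Rintegral_itvD; do ?[exact: form_continuous|apply: within_continuousD];
  do ?[exact: form_continuous].
rewrite !Rintegral_projection_form //.
rewrite [X in _ + (_ + X)]big1 => [|j _]; last first.
  by rewrite moment_residual mulmx0 mxE mulr0.
(* There remains the integral of the residual's form, nonnegative since x(s) >= 0 on the segment. *)
rewrite addr0 lerDr Rintegral_ge0 // => s; rewrite /= in_itv /= => /andP[sa _].
by rewrite mulr_ge0 // exprn_ge0 // divr_ge0 // subr_ge0 // ltW.
Qed.

End Bessel.

Theorem lemma3 (R : realType) (n : nat) (hn : (1 <= n)%N)
  (W : 'M[R]_n) (hW : sym_posdef W)
  (a b : R) (hab : a < b)
  (m M nu : nat) (hnu : (m + nu <= maxn 0 (M - 1))%N)
  (f df : R -> 'cV[R]_n) (hf : C1_with_derivative a b f df) :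
  J W m a b df >=
    (b - a)^-1 *
    ((Phi a b M f)^T *m (Zmx m nu M *t 1%:M)^T *m Wmx W m nu
       *m (Zmx m nu M *t 1%:M) *m Phi a b M f) 0 0.
Proof.
have ZPhi : (Zmx m nu M *t 1%:M) *m Phi a b M f =
    stack (fun j : 'I_nu.+1 => poly_moment a b (qpol m j) df).
  rewrite /Phi tensmx_stack; congr stack; apply/funext => j.
  rewrite -(Zmx_row (M := M) hab hf).
    by apply: eq_bigr => k _; rewrite mul1mx.
  (* Subtraction is truncated, so the bound is m + nu <= M - 1 even for M = 0, where it forces m =
     nu = 0. *)
  move: hnu; rewrite max0n => mnu; apply: leq_trans (leq_subr 1 M).
  by apply: leq_trans mnu; rewrite leq_add2l -ltnS.
rewrite -trmx_mul ZPhi -[_ *m _ *m Phi _ _ _ _]mulmxA ZPhi /Wmx stack_quadratic.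
apply: le_trans (bessel_form m nu hab (C1_coord_continuous hf) hW.1 _).
  (* The outer factor 1 / (b - a) combines with m + 2j + 1 to the Bessel coefficient of index j. *)
  rewrite summxE mulr_sumr; apply: ler_sum => j _.
  by rewrite mxE [(\row_ _ _) 0 j]mxE mulrA [_^-1 * _]mulrC.
move=> x; have [->|x0] := eqVneq x 0; first by rewrite mulmx0 mxE.
exact: ltW (hW.2 x x0).
Qed.
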